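(* Fix integers $N\ge1$ and $d\ge2$. There is a constant $C(N,d)$, depending only on $N$ and $d$, such that the following holds. Let $K$ be a number field or the completion of a number field, let $\bar K$ be an algebraic closure of $K$, and let $f:\mathbb{P}^N\to\mathbb{P}^N$ be an endomorphism of degree $d$ defined over $\bar K$ whose field of moduli is contained in $K$, i.e., for every $\sigma\in\operatorname{Gal}(\bar K/K)$ there exists $\varphi\in\operatorname{PGL}_{N+1}(\bar K)$ with $f^\sigma=\varphi^{-1}\circ f\circ\varphi$. Then there is a field of definition $L$ for $f$ (a field $K\subseteq L\subseteq\bar K$ such that for some $\varphi\in\operatorname{PGL}_{N+1}(\bar K)$ the conjugate $\varphi^{-1}\circ f\circ\varphi$ is defined over $L$) satisfying $[L:K]\le C(N,d)$.
   Context: For $f$ an endomorphism of $\mathbb{P}^N$ defined over $\bar K$ and $\sigma\in\operatorname{Gal}(\bar K/K)$, $f^\sigma$ denotes the endomorphism obtained by applying $\sigma$ to the coefficients of $f$. The automorphism group of $\mathbb{P}^N_{\bar K}$ is $\operatorname{PGL}_{N+1}(\bar K)$, and for $\varphi$ in it we write $f^\varphi:=\varphi^{-1}\circ f\circ\varphi$. The field of moduli of $f$ is the fixed field of $\{\sigma : \exists\varphi,\ f^\sigma=f^\varphi\}$. *)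

(* Defs.v *)
From HB Require Import structures.
From mathcomp Require Import all_boot all_order all_algebra.
From mathcomp Require Import mpoly.
From mathcomp Require Import reals.

Set Implicit Arguments.
Unset Strict Implicit.
Unset Printing Implicit Defensive.

Import Order.TTheory GRing.Theory Num.Theory.
Local Open Scope ring_scope.

Section Defs.
Variable F : fieldType.

Definition is_subfield (S : pred F) : Prop :=
  [/\ 0 \in S, 1 \in S,
      (forall x y, x \in S -> y \in S -> x - y \in S),
      (forall x y, x \in S -> y \in S -> x * y \in S) &
      (forall x, x \in S -> x^-1 \in S)].

Definition char0 : Prop := forall n : nat, (n.+1)%:R != 0 :> F.

Definition is_number_field (K : pred F) : Prop :=
  [/\ char0, is_subfield K &
      exists (m : nat) (b : 'I_m -> F),
        forall x, x \in K -> exists q : 'I_m -> rat,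
          x = \sum_(i < m) ratr (q i) * b i].

Definition is_completion_of_number_field (K : pred F) : Prop :=
  exists (R : realType) (absv : F -> R) (K0 : pred F),
  is_subfield K /\
      is_number_field K0 /\
      (forall x, x \in K0 -> x \in K) /\
      (forall x, x \in K -> 0 <= absv x /\ (absv x = 0 <-> x = 0)) /\
      (forall x y, x \in K -> y \in K -> absv (x * y) = absv x * absv y) /\
      (forall x y, x \in K -> y \in K -> absv (x + y) <= absv x + absv y) /\
      (forall u : nat -> F, (forall k, u k \in K) ->
         (forall e : R, 0 < e -> exists M, forall p q, (M <= p)%N -> (M <= q)%N ->
              absv (u p - u q) < e) ->
         exists2 l, l \in K &
           forall e : R, 0 < e -> exists M, forall p, (M <= p)%N -> absv (u p - l) < e) /\
      (forall x, x \in K -> forall e : R, 0 < e -> exists2 y, y \in K0 & absv (x - y) < e).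

Definition degree_le (K L : pred F) (C : nat) : Prop :=
  exists (m : nat) (b : 'I_m -> F), (m <= C)%N /\
    forall x, x \in L -> exists2 a : 'I_m -> F, (forall i, a i \in K) &
      x = \sum_(i < m) a i * b i.

Definition algebraic_over (K : pred F) : Prop :=
  forall x : F, exists p : {poly F},
    [/\ p != 0, (forall i, p`_i \in K) & root p x].

Definition in_Gal (K : pred F) (sigma : {rmorphism F -> F}) : Prop :=
  bijective sigma /\ forall x, x \in K -> sigma x = x.

Variable N : nat.

(* A tuple (f_0,...,f_N) of polynomials in N+1 variables (a lift of a map P^N -> P^N) *)
Definition poly_tuple := 'I_N.+1 -> {mpoly F[N.+1]}.

Definition is_endo (d : nat) (f : poly_tuple) : Prop :=
  (forall i, f i \is d.-homog) /\
  (forall x : 'I_N.+1 -> F, (forall i, (f i).@[x] = 0) -> forall j, x j = 0).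

Definition same_endo (f g : poly_tuple) : Prop :=
  exists2 c : F, c != 0 & forall i, g i = c *: f i.

Definition lin_forms (A : 'M[F]_N.+1) : N.+1.-tuple {mpoly F[N.+1]} :=
  [tuple \sum_(l < N.+1) A k l *: 'X_l | k < N.+1].

(* f^phi = phi^{-1} o f o phi, where phi is the class of the invertible matrix A *)
Definition conj_endo (A : 'M[F]_N.+1) (f : poly_tuple) : poly_tuple :=
  fun i => \sum_(j < N.+1) invmx A i j *: (f j \mPo lin_forms A).

Definition gal_act (sigma : {rmorphism F -> F}) (f : poly_tuple) : poly_tuple :=
  fun i => map_mpoly sigma (f i).

Definition defined_over (L : pred F) (f : poly_tuple) : Prop :=
  exists2 g : poly_tuple, same_endo f g & forall i m, (g i)@_m \in L.

Definition moduli_in (K : pred F) (f : poly_tuple) : Prop :=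
  forall sigma : {rmorphism F -> F}, in_Gal K sigma ->
    exists2 A : 'M[F]_N.+1, A \in unitmx & same_endo (gal_act sigma f) (conj_endo A f).

Definition field_of_definition (L : pred F) (f : poly_tuple) : Prop :=
  exists2 A : 'M[F]_N.+1, A \in unitmx & defined_over L (conj_endo A f).

End Defs.

(* Main.v *)
Require Import Defs.
From HB Require Import structures.
From mathcomp Require Import all_boot all_order all_algebra.
From mathcomp Require Import mpoly.
From mathcomp Require Import reals.
From mathcomp Require Import all_field zify ring boolp classical_sets.

Set Implicit Arguments.
Unset Strict Implicit.
Unset Printing Implicit Defensive.

Import GRing.Theory.
Local Open Scope ring_scope.

(* The coefficient vectors of the tuples adj(A) f(A x), for A invertible, form a
   subset Y of an affine space (the cone over the conjugacy orbit of f) which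
   is the image of a polynomial map y of degree bounded in terms of N and d.
   The field-of-moduli hypothesis says exactly that Y is stable under
   Gal(Kbar/K), and it suffices to find a point of Y of bounded degree over K.
   Choose coordinates y_s, s in S, completed by source coordinates x_k to a
   square system z with nonzero Jacobian determinant and with S as large as
   possible.  The z_k are algebraically independent, so for generic rational t
   the equation z(x) = t has a solution x.  By maximality every y_j satisfies
   a nontrivial relation over the y_s alone, and counting dimensions bounds
   its degree.  All Galois conjugates of the point y(x) lie in Y over the same
   rational values of the y_s, so each coordinate has boundedly many
   conjugates. *)

(** * Automorphisms of Kbar over K *)

(** One step of long division cancels the leading term. It is kept explicit so that the inductions
    below can track where the coefficients lie. *)
Lemma size_division_step (F : fieldType) (p r : {poly F}) :
  p != 0 -> (size p <= size r)%N ->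
  (size (r - (lead_coef r / lead_coef p)%:P * 'X^(size r - size p)%N * p)%R
     < size r)%N.
Proof.
move=> p0 lepr; have p_gt0 : (0 < size p)%N by rewrite size_poly_gt0.
have lc0 : lead_coef p != 0 by rewrite lead_coef_eq0.
have r_gt0 : (0 < size r)%N by apply: leq_trans lepr.
rewrite -[ltnRHS](prednK r_gt0) ltnS; apply/leq_sizeP => i lei.
rewrite coefB -mulrA coefCM coefXnM.
have -> : (i < size r - size p)%N = false.
  by apply/negbTE; rewrite -leqNgt; lia.
have [ei|ni] := eqVneq i (size r).-1.
  have -> : (i - (size r - size p))%N = (size p).-1 by rewrite ei; lia.
  by rewrite ei -!lead_coefE mulfVK // subrr.
have ltri : (size r <= i)%N by lia.
rewrite [r`_i]nth_default // [p`_(_ - _)]nth_default ?mulr0 ?subrr //.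
rewrite -(leq_add2r (size r - size p)) subnK ?subnKC //.
by apply: leq_trans ltri; apply: leq_subr.
Qed.

Section SubfieldClosure.
Variables (F : fieldType) (K : pred F).
Hypothesis subK : is_subfield K.

Lemma subfield0 : 0 \in K. Proof. by case: subK. Qed.
Lemma subfield1 : 1 \in K. Proof. by case: subK. Qed.
Lemma subfieldB x y : x \in K -> y \in K -> x - y \in K.
Proof. by case: subK => _ _ + _ _; apply. Qed.
Lemma subfieldM x y : x \in K -> y \in K -> x * y \in K.
Proof. by case: subK => _ _ _ + _; apply. Qed.
Lemma subfieldV x : x \in K -> x^-1 \in K.
Proof. by case: subK => _ _ _ _; apply. Qed.
Lemma subfieldN x : x \in K -> - x \in K.
Proof. by move=> ?; rewrite -sub0r subfieldB ?subfield0. Qed.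
Lemma subfieldD x y : x \in K -> y \in K -> x + y \in K.
Proof. by move=> ? ?; rewrite -[y]opprK subfieldB ?subfieldN. Qed.
Lemma subfield_sum (I : Type) (r : seq I) (P : pred I) (E : I -> F) :
  (forall i, P i -> E i \in K) -> \sum_(i <- r | P i) E i \in K.
Proof.
by move=> EK; elim/big_ind: _ => //; [exact: subfield0 | exact: subfieldD].
Qed.
Lemma subfield_nat n : n%:R \in K.
Proof. by elim: n => [|n IH]; rewrite ?subfield0 // mulrS subfieldD ?subfield1. Qed.

(** Strip factors ['X] from an annihilator of [x] until its constant term [c] is nonzero; then [x *
    p.[x] = - c], and dividing by [- c] inverts [x] inside [K[x]]. *)
Lemma algebraic_inv_horner (x : F) : algebraic_over K -> x != 0 ->
  exists2 q : {poly F}, (forall i, q`_i \in K) & x * q.[x] = 1.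
Proof.
move=> /(_ x)[p [p0 pK /rootP px]] x0.
elim/poly_ind: p p0 pK px => [|p c IH]; first by rewrite eqxx.
move=> pc0 pcK; rewrite hornerMXaddC => px.
have cK : c \in K.
  by have := pcK 0; rewrite coefD coefMX coefC !eqxx add0r.
have pK i : p`_i \in K by have := pcK i.+1; rewrite coefD coefMX coefC !addr0.
have [c0|c0] := eqVneq c 0.
  apply: IH => //; first by apply: contraNneq pc0 => ->; rewrite c0 mul0r addr0.
  by move/eqP: px; rewrite c0 addr0 mulf_eq0 (negbTE x0) orbF => /eqP.
exists (- c^-1 *: p) => [i|].
  by rewrite coefZ subfieldM ?subfieldN ?subfieldV.
rewrite hornerZ; have -> : c = - (p.[x] * x).
  by apply/eqP; rewrite -addr_eq0 addrC px.
rewrite invrN opprK mulrCA [x * _]mulrC mulVf //.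
by apply: contraNneq c0 => px0; move: px; rewrite px0 add0r => ->.
Qed.

End SubfieldClosure.

(** * Extending partial K-embeddings to automorphisms *)

Section PartialEmbeddings.
Variables (F : closedFieldType) (K : pred F).
Hypotheses (subK : is_subfield K) (algK : algebraic_over K).

(* [G] is the graph of a K-embedding of a subring of F into F; closure under
   inverses is automatic because F is algebraic over K. *)
Definition embedding_graph (G : set (F * F)) : Prop :=
  [/\ forall x, x \in K -> G (x, x),
      forall a b c d, G (a, b) -> G (c, d) -> G (a - c, b - d),
      forall a b c d, G (a, b) -> G (c, d) -> G (a * c, b * d) &
      forall y, G (0, y) -> y = 0].

Definition coef_related (G : set (F * F)) (p q : {poly F}) : Prop :=
  forall i, G (p`_i, q`_i).

Section Fixed.
Variable G : set (F * F).
Hypothesis gG : embedding_graph G.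

Let GK x : x \in K -> G (x, x). Proof. by case: gG => + _ _ _; apply. Qed.
Let GB a b c d : G (a, b) -> G (c, d) -> G (a - c, b - d).
Proof. by case: gG => _ + _ _; apply. Qed.
Let GM a b c d : G (a, b) -> G (c, d) -> G (a * c, b * d).
Proof. by case: gG => _ _ + _; apply. Qed.
Let G0 y : G (0, y) -> y = 0. Proof. by case: gG => _ _ _; apply. Qed.
Let G00 : G (0, 0). Proof. by apply/GK/subfield0. Qed.
Let G11 : G (1, 1). Proof. by apply/GK/subfield1. Qed.
Let GD a b c d : G (a, b) -> G (c, d) -> G (a + c, b + d).
Proof.
by move=> ab cd; rewrite -[c]opprK -[d]opprK -(sub0r c) -(sub0r d); do 2!apply: GB => //.
Qed.

Let Gsum (I : Type) (r : seq I) (P : pred I) (E E' : I -> F) :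
  (forall i, P i -> G (E i, E' i)) ->
  G (\sum_(i <- r | P i) E i, \sum_(i <- r | P i) E' i).
Proof.
move=> h; pose R (a b : F) := G (a, b).
by apply: (big_ind2 R) => //; rewrite /R => *; apply: GD.
Qed.

Let GX a b n : G (a, b) -> G (a ^+ n, b ^+ n).
Proof. by move=> ab; elim: n => // n IH; rewrite !exprS; apply: GM. Qed.

Lemma embedding_graph_functional a b c : G (a, b) -> G (a, c) -> b = c.
Proof.
by move=> ab ac; have := GB ab ac; rewrite subrr => /G0/eqP; rewrite subr_eq0 => /eqP.
Qed.

Lemma embedding_graph_horner p q a b :
  coef_related G p q -> G (a, b) -> G (p.[a], q.[b]).
Proof.
move=> pq ab; rewrite (horner_coef_wide _ (leq_maxl (size p) (size q))).
rewrite (horner_coef_wide _ (leq_maxr (size p) (size q))).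
by apply: Gsum => i _; apply: GM => //; apply: GX.
Qed.

Let coefK (p : {poly F}) : (forall i, p`_i \in K) -> coef_related G p p.
Proof. by move=> pK i; apply: GK. Qed.

(** The inverse of [a] is a polynomial in [a] over [K]. Since [G] fixes [K], the same polynomial at
    [b] corresponds to it and inverts [b]. *)
Lemma embedding_graph_inv a b : a != 0 -> G (a, b) -> G (a^-1, b^-1).
Proof.
move=> a0 ab; have [q qK aq] := algebraic_inv_horner subK algK a0.
have qab := embedding_graph_horner (coefK qK) ab.
have bq : b * q.[b] = 1.
  by have := GM ab qab; rewrite aq => /embedding_graph_functional; apply.
have b0 : b != 0.
  by apply/eqP => b0; move: bq; rewrite b0 mul0r => /esym/eqP; rewrite oner_eq0.
rewrite -[a^-1]mulr1 -[b^-1]mulr1 -{1}aq -bq !mulKf //.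
Qed.

Lemma embedding_graph_inj0 a : G (a, 0) -> a = 0.
Proof.
move=> a0; apply/eqP/negPn/negP => an0.
have := GM a0 (embedding_graph_inv an0 a0); rewrite mulfV // mul0r.
by move=> /embedding_graph_functional/(_ G11)/eqP; rewrite eq_sym oner_eq0.
Qed.

Lemma coef_relatedB p q r s :
  coef_related G p q -> coef_related G r s -> coef_related G (p - r) (q - s).
Proof. by move=> pq rs i; rewrite !coefB; apply: GB. Qed.

Lemma coef_relatedM p q r s :
  coef_related G p q -> coef_related G r s -> coef_related G (p * r) (q * s).
Proof. by move=> pq rs i; rewrite !coefM; apply: Gsum => j _; apply: GM. Qed.

Lemma coef_relatedC a b : G (a, b) -> coef_related G a%:P b%:P.
Proof. by move=> ab i; rewrite !coefC; case: eqP. Qed.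

Lemma coef_relatedX : coef_related G 'X 'X.
Proof. by move=> i; rewrite !coefX; case: eqP. Qed.

Lemma coef_relatedXn n : coef_related G 'X^n 'X^n.
Proof. by move=> i; rewrite !coefXn; case: eqP. Qed.

Lemma coef_related_size p q : coef_related G p q -> size p = size q.
Proof.
move=> pq; apply/eqP; rewrite eqn_leq; apply/andP; split; apply/leq_sizeP => i lei.
  by have := pq i; rewrite [q`_i]nth_default // => /embedding_graph_inj0.
by have := pq i; rewrite [p`_i]nth_default // => /G0.
Qed.

(** Divide [r] by [p] and [r'] by [p'] in parallel. The remainder of [r] kills [x] and is smaller
    than the minimal [p], so it is zero, and so is its partner; hence [r'] is a multiple of [p']. *)
Lemma coef_related_root_transfer p p' x y :
    coef_related G p p' -> p != 0 -> p'.[y] = 0 -> p.[x] = 0 ->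
    (forall r r', coef_related G r r' -> r != 0 -> r.[x] = 0 -> (size p <= size r)%N) ->
  forall r r', coef_related G r r' -> r.[x] = 0 -> r'.[y] = 0.
Proof.
move=> pp' p0 p'y px pmin r r'.
elim: {r}(size r).+1 {-2}r r' (ltnSn (size r)) => // n IH r r' ltrn rr' rx.
have [r0|r0] := eqVneq r 0.
  have := coef_related_size rr'; rewrite r0 size_poly0 => /esym/eqP.
  by rewrite size_poly_eq0 => /eqP ->; rewrite horner0.
have lepr := pmin _ _ rr' r0 rx.
pose c := lead_coef r / lead_coef p; pose c' := lead_coef r' / lead_coef p'.
pose k := (size r - size p)%N.
have cc' : G (c, c').
  apply: GM; first by rewrite !lead_coefE -(coef_related_size rr').
  by apply: embedding_graph_inv; rewrite ?lead_coef_eq0 // !lead_coefE -(coef_related_size pp').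
pose s := r - c%:P * 'X^k * p; pose s' := r' - c'%:P * 'X^k * p'.
have ss' : coef_related G s s'.
  apply: coef_relatedB => //; apply: coef_relatedM => //.
  by apply: coef_relatedM; [exact: coef_relatedC | exact: coef_relatedXn].
have sx : s.[x] = 0 by rewrite hornerD hornerN hornerM px mulr0 rx subrr.
have lts : (size s < size r)%N by apply: size_division_step.
have := IH s s' (leq_trans lts ltrn) ss' sx.
by rewrite hornerD hornerN hornerM p'y mulr0 subr0.
Qed.

(** The extension sends [r.[x]] to [r'.[y]], where [r'] is the transport of [r]. It is well defined
    by the root transfer above. *)
Lemma embedding_graph_adjoin p p' x y :
    coef_related G p p' -> p != 0 -> p'.[y] = 0 -> p.[x] = 0 ->
    (forall r r', coef_related G r r' -> r != 0 -> r.[x] = 0 -> (size p <= size r)%N) ->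
  exists G', [/\ embedding_graph G', (G `<=` G')%classic & G' (x, y)].
Proof.
move=> pp' p0 p'y px pmin.
pose H (z : F * F) := exists r r', coef_related G r r' /\ z = (r.[x], r'.[y]).
exists H; split; last by exists 'X, 'X; split; [exact: coef_relatedX | rewrite !hornerX].
- split.
  + move=> c cK; exists c%:P, c%:P; split; last by rewrite !hornerC.
    by apply/coef_relatedC/GK.
  + move=> a b c d [r [r' [rr' [-> ->]]]] [s [s' [ss' [-> ->]]]].
    exists (r - s), (r' - s'); split; first exact: coef_relatedB.
    by rewrite !hornerE.
  + move=> a b c d [r [r' [rr' [-> ->]]]] [s [s' [ss' [-> ->]]]].
    exists (r * s), (r' * s'); split; first exact: coef_relatedM.
    by rewrite !hornerE.
  + move=> z [r [r' [rr' [/esym rx ->]]]].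
    exact: coef_related_root_transfer rr' rx.
- move=> [a b] ab; exists a%:P, b%:P; split; last by rewrite !hornerC.
  exact: coef_relatedC.
Qed.

Lemma minimal_annihilator x : exists p p',
  [/\ coef_related G p p', p != 0, p.[x] = 0 &
   forall r r', coef_related G r r' -> r != 0 -> r.[x] = 0 -> (size p <= size r)%N].
Proof.
pose S (n : nat) := `[< exists p p', [/\ coef_related G p p', p != 0, p.[x] = 0 & size p = n] >].
have exS : exists n, S n.
  have [p [p0 pK /rootP px]] := algK x; exists (size p); apply/asboolP.
  by exists p, p; split=> //; exact: coefK.
case: (ex_minnP exS) => n /asboolP[p [p' [pp' p0 px sp]]] nmin.
exists p, p'; split=> // r r' rr' r0 rx; rewrite sp; apply: nmin.
by apply/asboolP; exists r, r'; split.
Qed.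

(** The transported minimal polynomial [p'] has the size of [p], hence is not constant, and has a
    root in the closed field. *)
Lemma embedding_graph_extend x :
  exists y G', [/\ embedding_graph G', (G `<=` G')%classic & G' (x, y)].
Proof.
have [p [p' [pp' p0 px pmin]]] := minimal_annihilator x.
have : size p' != 1.
  rewrite -(coef_related_size pp'); apply/negP => /size_poly1P[c c0 pc].
  by move: px; rewrite pc hornerC => /eqP; rewrite (negbTE c0).
move=> /closed_rootP[y /rootP p'y]; exists y.
exact: (embedding_graph_adjoin pp').
Qed.

End Fixed.

Lemma embedding_graph_diag : embedding_graph (fun z => z.1 = z.2 /\ z.1 \in K).
Proof.
split=> //=.
- by move=> a b c d [<- aK] [<- cK]; split=> //; apply: subfieldB.
- by move=> a b c d [<- aK] [<- cK]; split=> //; apply: subfieldM.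
- by move=> y [].
Qed.

Lemma embedding_graph_total G0 : embedding_graph G0 ->
  exists G, [/\ embedding_graph G, (G0 `<=` G)%classic & forall x, exists y, G (x, y)].
Proof.
move=> g0; pose P (G : set (F * F)) := G = set0 \/ (embedding_graph G /\ (G0 `<=` G)%classic).
have [|A [PA Amax]] := @Zorn_bigcup _ P.
  move=> C CP Ctot.
  have [[X CX X0]|noX] := pselect (exists2 X, C X & X <> set0); last first.
    left; apply/seteqP; split=> // z [X CX Xz].
    by case: noX; exists X => // X0; rewrite X0 in Xz.
  have good Y z : C Y -> Y z -> embedding_graph Y /\ (G0 `<=` Y)%classic.
    by move=> CY Yz; case: (CP _ CY) => // Y0; rewrite Y0 in Yz.
  have [gX sX] : embedding_graph X /\ (G0 `<=` X)%classic by case: (CP _ CX).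
  have common z w Y Z : C Y -> C Z -> Y z -> Z w ->
      exists2 W, C W & [/\ embedding_graph W, W z & W w].
    move=> CY CZ Yz Zw; case: (Ctot _ _ CY CZ) => YZ.
      by exists Z => //; split=> //; [case: (good _ _ CZ Zw) | apply: YZ].
    by exists Y => //; split=> //; [case: (good _ _ CY Yz) | apply: YZ].
  right; split; last by move=> z /sX Xz; exists X.
  split.
  - by move=> x xK; exists X => //; case: gX => + _ _ _; apply.
  - move=> a b c d [Y CY Yz] [Z CZ Zw].
    have [W CW [[_ h _ _] Wz Ww]] := common _ _ _ _ CY CZ Yz Zw.
    by exists W => //; apply: h.
  - move=> a b c d [Y CY Yz] [Z CZ Zw].
    have [W CW [[_ _ h _] Wz Ww]] := common _ _ _ _ CY CZ Yz Zw.
    by exists W => //; apply: h.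
  - by move=> y [Y CY Yz]; case: (good _ _ CY Yz) => -[_ _ _ h] _; exact: h.
have G00 : G0 (0, 0) by case: g0 => + _ _ _; apply; apply: subfield0.
case: PA => [A0|[gA sA]].
  have AG0 : (A `<` G0)%classic by rewrite A0; split=> // /(_ _ G00).
  by case: (Amax _ AG0); right; split.
exists A; split=> // x.
have [y [G' [gG' AG' Gxy]]] := embedding_graph_extend gA x.
exists y; apply: contrapT => nAxy.
have ltAG' : (A `<` G')%classic by split=> // /(_ _ Gxy).
by case: (Amax _ ltAG'); right; split=> //; apply: subset_trans AG'.
Qed.

Lemma total_embedding_graph_Gal G : embedding_graph G ->
  (forall x, exists y, G (x, y)) ->
  exists2 sigma : {rmorphism F -> F}, in_Gal K sigma & forall x, G (x, sigma x).
Proof.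
move=> gG /choice[s Gs].
have fG := embedding_graph_functional gG.
have sK x : x \in K -> s x = x.
  by move=> xK; apply: (fG x) => //; case: gG => + _ _ _; apply.
have sB : {morph s : x y / x - y}.
  by move=> x y; apply: (fG (x - y)) => //; case: gG => _ + _ _; apply.
have sM : {morph s : x y / x * y}.
  by move=> x y; apply: (fG (x * y)) => //; case: gG => _ _ + _; apply.
have s1 : s 1 = 1 by apply: sK; exact: subfield1.
pose sA := GRing.isZmodMorphism.Build F F s sB.
pose sMm := GRing.isMonoidMorphism.Build F F s (conj s1 sM).
pose sigma : {rmorphism F -> F} := HB.pack s sA sMm.
exists sigma => //; split=> //.
have sinj : injective sigma by apply: fmorph_inj.
(* An annihilator [p] of [y] over [K] is fixed by [sigma], so [sigma] maps the finite root set of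
   [p] injectively into itself, hence onto it. *)
have ssurj y : exists x, sigma x = y.
  have [p [p0 pK py]] := algK y.
  have [rs prs] := closed_field_poly_normal p.
  have rp z : root p z = (z \in undup rs).
    by rewrite mem_undup prs rootZ ?lead_coef_eq0 // root_prod_XsubC.
  have sub : {subset map sigma (undup rs) <= undup rs}.
    move=> _ /mapP[z + ->]; rewrite -!rp => /rootP pz; apply/rootP.
    have -> : p = map_poly sigma p.
      by apply/polyP => i; rewrite coef_map /= sK.
    by rewrite horner_map pz rmorph0.
  have um : uniq (map sigma (undup rs)) by rewrite map_inj_uniq ?undup_uniq.
  have [|_ eqs] := uniq_min_size um sub; first by rewrite size_map.
  by have := eqs y; rewrite -rp py => /mapP[x _ ->]; exists x.
have [t tK] := choice ssurj.
by exists t => // x; apply: sinj; rewrite tK.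
Qed.

End PartialEmbeddings.

(** * Galois orbits and degrees *)

Section Conjugates.
Variables (F : closedFieldType) (K : pred F).
Hypotheses (subK : is_subfield K) (algK : algebraic_over K) (charF : char0 F).

(** Take [q] to be a minimal polynomial of [v] over [K]. Its roots are all conjugates of [v], hence
    roots of [p], and in characteristic 0 they are distinct, so [q] has at most the degree of
    [p]. *)
Lemma Gal_orbit_degree (v : F) (p : {poly F}) : p != 0 ->
    (forall sigma : {rmorphism F -> F}, in_Gal K sigma -> root p (sigma v)) ->
  exists q : {poly F},
    [/\ q != 0, (forall i, q`_i \in K), root q v & (size q <= size p)%N].
Proof.
move=> p0 pv.
pose G0 (z : F * F) := z.1 = z.2 /\ z.1 \in K.
have g0 : embedding_graph K G0 := embedding_graph_diag subK.
have [q [q' [qq' q0 qv qmin]]] := minimal_annihilator algK g0 v.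
have eqq : q = q' by apply/polyP => i; have [] := qq' i.
have qK i : q`_i \in K by have [] := qq' i.
have conjugate u : root q u -> exists2 sigma : {rmorphism F -> F}, in_Gal K sigma & sigma v = u.
  move=> /rootP qu; rewrite -eqq in qq'.
  have [G' [gG' sG' Gvu]] := embedding_graph_adjoin subK algK g0 qq' q0 qu qv qmin.
  have [G [gG sG totG]] := embedding_graph_total subK algK gG'.
  have [sigma sGal Gs] := total_embedding_graph_Gal subK algK gG totG.
  by exists sigma => //; apply: (embedding_graph_functional gG (Gs v)); apply: sG.
have dK i : q^`()`_i \in K.
  by rewrite coef_deriv -mulr_natr subfieldM ?subfield_nat.
have ltd : (size q^`() < size q)%N by apply: lt_size_deriv.
have q_gt1 : (1 < size q)%N.
  rewrite ltnNge; apply/negP => /size1_polyC qc.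
  move: qv q0; rewrite qc hornerC => ->; by rewrite polyC0 eqxx.
have d0 : q^`() != 0.
  apply/eqP => /polyP/(_ (size q).-2); rewrite coef0 coef_deriv -mulr_natr.
  move=> /eqP; rewrite mulf_eq0 (negbTE (charF _)) orbF.
  have -> : (size q).-2.+1 = (size q).-1 by lia.
  by rewrite -lead_coefE lead_coef_eq0 (negbTE q0).
(* A common root of [q] and its derivative is some [sigma v]. Applying the inverse of [sigma], the
   derivative kills [v], against the minimality of [q]. *)
have sep : separable_poly q.
  rewrite unlock /coprimep; apply/negPn/negP => /closed_rootP[u].
  rewrite root_gcd => /andP[/conjugate[sigma [_ sK] <-] /rootP du].
  have dv : q^`().[v] = 0.
    apply: (fmorph_inj sigma); rewrite rmorph0 -du -horner_map; congr (_.[_]).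
    by apply/polyP => i; rewrite coef_map /= sK.
  have := qmin _ q^`() _ d0 dv; rewrite leqNgt ltd => h.
  by have := h (fun i => conj erefl (dK i)).
have [rs qrs] := closed_field_poly_normal q.
have lc0 : lead_coef q != 0 by rewrite lead_coef_eq0.
have urs : uniq rs.
  rewrite -separable_prod_XsubC; move: sep; rewrite qrs.
  by rewrite (eqp_separable (eqp_scale _ lc0)).
exists q; split=> //; first exact/rootP.
have -> : size q = (size rs).+1.
  by rewrite qrs size_scale // size_prod_XsubC.
apply: max_poly_roots => //; apply/allP => u urs'.
have [|sigma sG <-] := conjugate u; last exact: pv.
by rewrite qrs rootZ // root_prod_XsubC.
Qed.

End Conjugates.

(** * Finite extensions inside Kbar *)

Section Towers.
Variable F : fieldType.

Lemma degree_le_trans (K L M : pred F) a b :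
  (forall x y, x \in K -> y \in K -> x * y \in K) ->
  degree_le K L a -> degree_le L M b -> degree_le K M (a * b).
Proof.
move=> KM [m [c [lema cL]]] [n [e [lenb eM]]].
pose T : finType := ('I_m * 'I_n)%type.
exists #|T|, (fun k => c (enum_val k).1 * e (enum_val k).2); split.
  by rewrite card_prod !card_ord leq_mul.
move=> x /eM[l lL ->].
have /choice[g gP] : forall j, exists g : 'I_m -> F,
    (forall i, g i \in K) /\ l j = \sum_(i < m) g i * c i.
  by move=> j; have [g gK ->] := cL _ (lL j); exists g.
exists (fun k => g (enum_val k).2 (enum_val k).1) => [k|].
  by have [] := gP (enum_val k).2.
pose E (p : T) := g p.2 p.1 * (c p.1 * e p.2).
rewrite -(big_enum_val E) /= -(pair_big predT predT (fun i j => E (i, j))) /=.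
rewrite exchange_big /=; apply: eq_bigr => j _.
have [_ ->] := gP j; rewrite mulr_suml; apply: eq_bigr => i _.
by rewrite /E mulrA.
Qed.

Lemma degree_le_refl (K : pred F) : degree_le K K 1.
Proof.
exists 1%N, (fun=> 1); split=> // x xK.
by exists (fun=> x) => //; rewrite big_ord1 mulr1.
Qed.

Lemma degree_leW (K L : pred F) a b : (a <= b)%N -> degree_le K L a -> degree_le K L b.
Proof.
by move=> leab [m [c [lema cL]]]; exists m, c; split=> //; apply: leq_trans leab.
Qed.

Lemma algebraic_overS (K L : pred F) :
  (forall x, x \in K -> x \in L) -> algebraic_over K -> algebraic_over L.
Proof.
move=> KL algK x; have [p [p0 pK px]] := algK x.
by exists p; split=> // i; apply: KL.
Qed.

Section Adjoin.
Variable K : pred F.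
Hypotheses (subK : is_subfield K) (algK : algebraic_over K).

Let coefK_C c : c \in K -> forall i, (c%:P)`_i \in K.
Proof. by move=> cK i; rewrite coefC; case: eqP => // _; exact: subfield0. Qed.
Let coefK_B (p q : {poly F}) : (forall i, p`_i \in K) -> (forall i, q`_i \in K) ->
  forall i, (p - q)`_i \in K.
Proof. by move=> pK qK i; rewrite coefB; apply: subfieldB. Qed.
Let coefK_M (p q : {poly F}) : (forall i, p`_i \in K) -> (forall i, q`_i \in K) ->
  forall i, (p * q)`_i \in K.
Proof.
by move=> pK qK i; rewrite coefM; apply: subfield_sum => // j _; apply: subfieldM.
Qed.
Let coefK_Xn n i : ('X^n : {poly F})`_i \in K.
Proof. by rewrite coefXn; case: eqP => _; [exact: subfield1 | exact: subfield0]. Qed.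

Lemma horner_reduce (q : {poly F}) v : q != 0 -> (forall i, q`_i \in K) -> root q v ->
  forall r : {poly F}, (forall i, r`_i \in K) -> exists s : {poly F},
    [/\ forall i, s`_i \in K, (size s < size q)%N & r.[v] = s.[v]].
Proof.
move=> q0 qK /rootP qv r.
have q_gt0 : (0 < size q)%N by rewrite size_poly_gt0.
elim: {r}(size r).+1 {-2}r (ltnSn (size r)) => // n IH r ltrn rK.
case: (ltnP (size r) (size q)) => [ltrq|leqr]; first by exists r.
pose c := lead_coef r / lead_coef q; pose k := (size r - size q)%N.
pose r1 := r - c%:P * 'X^k * q.
have r1K : forall i, r1`_i \in K.
  apply: coefK_B => //; apply: coefK_M => //; apply: coefK_M => //.
  apply: coefK_C; apply: subfieldM => //; first by rewrite lead_coefE.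
  by apply: subfieldV => //; rewrite lead_coefE.
have r1v : r1.[v] = r.[v] by rewrite hornerD hornerN hornerM qv mulr0 subr0.
have lts : (size r1 < size r)%N by apply: size_division_step.
have [s [sK lesq r1s]] := IH r1 (leq_trans lts ltrn) r1K.
by exists s; split=> //; rewrite -r1v.
Qed.

(** The field is [K[v]]: inverses are polynomials over [K] in the element itself, and reduction
    modulo [q] leaves the powers of [v] below [(size q).-1], the degree of [q], as a spanning
    family. *)
Lemma adjoin_algebraic (q : {poly F}) v :
    q != 0 -> (forall i, q`_i \in K) -> root q v ->
  exists L : pred F, [/\ is_subfield L, forall x, x \in K -> x \in L, v \in L &
    degree_le K L (size q).-1].
Proof.
move=> q0 qK qv.
have red := horner_reduce q0 qK qv.
pose L : pred F := fun x => `[< exists2 r : {poly F}, (forall i, r`_i \in K) & x = r.[v] >].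
have LP x : reflect (exists2 r : {poly F}, (forall i, r`_i \in K) & x = r.[v]) (x \in L).
  exact: asboolP.
have KL x : x \in K -> x \in L.
  by move=> xK; apply/LP; exists x%:P; [exact: coefK_C | rewrite hornerC].
have LB x y : x \in L -> y \in L -> x - y \in L.
  move=> /LP[r rK ->] /LP[s sK ->]; apply/LP; exists (r - s); first exact: coefK_B.
  by rewrite !hornerE.
have LM x y : x \in L -> y \in L -> x * y \in L.
  move=> /LP[r rK ->] /LP[s sK ->]; apply/LP; exists (r * s); first exact: coefK_M.
  by rewrite !hornerE.
have L0 : 0 \in L by apply/KL/subfield0.
have L1 : 1 \in L by apply/KL/subfield1.
have LD x y : x \in L -> y \in L -> x + y \in L.
  by move=> xL yL; rewrite -[y]opprK -(sub0r y) !LB.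
exists L; split=> //.
- split=> // x xL; have [->|x0] := eqVneq x 0; first by rewrite invr0.
  have [t tK xt] := algebraic_inv_horner subK algK x0.
  rewrite -[x^-1]mulr1 -xt mulKf // horner_coef.
  elim/big_ind: _ => // i _; rewrite LM //; first exact: KL.
  by elim: (val i) => // n IH; rewrite exprS LM.
- by apply/LP; exists 'X; [exact: (coefK_Xn 1) | rewrite hornerX].
- exists (size q).-1, (fun i => v ^+ i); split=> // x /LP[r /red[s [sK ltsq ->]] ->].
  exists (fun i => s`_i) => //; rewrite (@horner_coef_wide _ (size q).-1) //.
  by rewrite -ltnS (leq_trans ltsq) // leqSpred.
Qed.

End Adjoin.

Lemma adjoin_algebraic_seq (K : pred F) (B : nat) (vs : seq F) :
    is_subfield K -> algebraic_over K ->
    (forall v, v \in vs -> exists q : {poly F},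
       [/\ q != 0, (forall i, q`_i \in K), root q v & (size q <= B.+1)%N]) ->
  exists L : pred F, [/\ is_subfield L, forall x, x \in K -> x \in L,
    forall v, v \in vs -> v \in L & degree_le K L (B ^ size vs)].
Proof.
move=> subK algK; elim: vs => [_|v vs IH vsP]; first by exists K; split=> //; exact: degree_le_refl.
have [w wvs|L [subL KL vsL dL]] := IH; first by apply: vsP; rewrite inE wvs orbT.
have [|q [q0 qK qv leq]] := vsP v; first exact: mem_head.
have [M [subM LM vM dM]] :=
  adjoin_algebraic subL (algebraic_overS KL algK) q0 (fun i => KL _ (qK i)) qv.
exists M; split=> // [x xK|w|]; first exact/LM/KL.
  by rewrite inE => /predU1P[-> //|/vsL]; apply: LM.
rewrite expnSr; apply: degree_le_trans dL _; first by move=> *; apply: subfieldM.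
by apply: degree_leW dM; rewrite -ltnS (leq_trans _ leq) // ltn_predL size_poly_gt0.
Qed.

End Towers.

(** * Evaluation and derivatives of multivariate polynomials *)

Section Extend.
Variables (T : Type) (n : nat).

(** The new value goes to the last index because [muni] singles out the last variable. *)
Definition ord_rcons (t : 'I_n -> T) (x : T) (i : 'I_n.+1) : T :=
  oapp t x (unlift ord_max i).

Lemma ord_rcons_max t x : ord_rcons t x ord_max = x.
Proof. by rewrite /ord_rcons unlift_none. Qed.

Lemma ord_rcons_lift t x i : ord_rcons t x (lift ord_max i) = t i.
Proof. by rewrite /ord_rcons liftK. Qed.

Lemma widen_ord_lift (i : 'I_n) : widen_ord (leqnSn n) i = lift ord_max i.
Proof. by apply/val_inj; exact/esym/lift_max. Qed.

End Extend.

Section LastVariable.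
Variables (n : nat) (R : comNzRingType).
Implicit Types (p : {mpoly R[n.+1]}) (t : 'I_n -> R).

Lemma meval_muni p t x :
  p.@[ord_rcons t x] = (map_poly (meval t) (muni p)).[x].
Proof.
rewrite muniE mevalE rmorph_sum horner_sum; apply: eq_bigr => m _.
rewrite /= map_polyZ /= mevalZ mevalX map_polyXn hornerZ hornerXn -mulrA.
rewrite big_ord_recr /= ord_rcons_max; congr (_ * (_ * _)).
by apply: eq_bigr => i _; rewrite mnmE widen_ord_lift ord_rcons_lift.
Qed.

Lemma size_muni p : (size (muni p) <= msize p)%N.
Proof.
rewrite muniE; apply: (leq_trans (size_sum _ _ _)).
apply/bigmax_leqP_seq => m mp _; apply: (leq_trans (size_scale_leq _ _)).
rewrite size_polyXn; apply: leq_trans (msize_mdeg_lt mp).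
by rewrite mdegE (bigD1 ord_max) //= ltnS leq_addr.
Qed.

(** A monomial is recovered from its last exponent and its remaining exponents, so no two terms
    merge. *)
Lemma muni_eq0 p : muni p = 0 -> p = 0.
Proof.
move=> p0; apply/mpolyP => m; rewrite mcoeff0.
have [mp|] := boolP (m \in msupp p); last by rewrite -mcoeff_eq0 => /eqP.
have := congr1 (fun q : {poly {mpoly R[n]}} =>
  (q`_(m ord_max))@_[multinom (m (widen_ord (leqnSn n) i)) | i < n]) p0.
rewrite muniE coef0 mcoeff0 coef_sum raddf_sum /= (bigD1_seq m) ?msupp_uniq //=.
rewrite coefZ coefXn eqxx mulr1 mcoeffZ mcoeffX eqxx mulr1 big1 ?addr0 // => m' m'm.
rewrite coefZ coefXn; case: eqP => [e|_]; rewrite ?mulr0 ?mcoeff0 //.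
rewrite mulr1 mcoeffZ mcoeffX; case: eqP => [/mnmP e'|_]; rewrite ?mulr0 //.
case/eqP: m'm; apply/mnmP => i.
have [j ->|->] := unliftP ord_max i; last by rewrite e.
by have := e' j; rewrite !mnmE widen_ord_lift.
Qed.

End LastVariable.

(** Induct on the number of variables: keep one coefficient in the last variable nonzero, then avoid
    the finitely many roots of the resulting univariate polynomial. *)
Lemma mpoly_nonroot_nat (F : fieldType) (n : nat) (h : {mpoly F[n]}) :
  char0 F -> h != 0 -> exists t : 'I_n -> nat, h.@[fun i => (t i)%:R] != 0.
Proof.
move=> charF; elim: n h => [|n IH] h h0.
  have hE : h = (h@_0)%:MP.
    apply/mpolyP => m; have -> : m = 0%MM by apply/mnmP => -[].
    by rewrite mcoeffC eqxx mulr1.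
  exists (fun=> 0%N); move: h0; rewrite hE mevalC.
  by apply: contraNneq => ->; rewrite mpolyC0.
have /eqP/polyP u0 : muni h != 0 by apply: contraNneq h0 => /muni_eq0 ->.
have [j /eqP uj] : exists j, (muni h)`_j <> 0.
  by apply: contrapT => /forallNP a; apply: u0 => j; rewrite coef0; apply: contrapT.
have [t ht] := IH _ uj.
pose p := map_poly (meval (fun i => (t i)%:R)) (muni h).
have p0 : p != 0.
  by apply/eqP => /polyP/(_ j); rewrite coef_map coef0 => /eqP; rewrite (negbTE ht).
have inj : injective (fun k : nat => k%:R : F).
  have le k l : (k <= l)%N -> k%:R = l%:R :> F -> k = l.
    move=> lekl /eqP; rewrite eq_sym -subr_eq0 -natrB //.
    case E: (l - k)%N => [|e]; last by rewrite (negbTE (charF _)).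
    by move=> _; lia.
  by move=> k l; case/orP: (leq_total k l) => /le + e => [|/(_ (esym e))]; [apply|].
(* The [size p] distinct values [0, ..., size p - 1] exceed the degree of [p], so they cannot all be
   roots. *)
have [x px] : exists x : nat, p.[x%:R] != 0.
  apply: contrapT => /forallNP a.
  have := @max_poly_roots _ p [seq k%:R | k <- iota 0 (size p)] p0.
  rewrite map_inj_uniq ?iota_uniq // size_map size_iota ltnn.
  suff -> : all (root p) [seq k%:R | k <- iota 0 (size p)] by move=> /(_ isT isT).
  by apply/allP => _ /mapP[k _ ->]; apply/rootP/eqP/negPn/negP => /a.
exists (ord_rcons t x); apply: contraNneq px => h00.
rewrite -meval_muni -h00; apply/eqP/meval_eq => i.
by have [k ->|->] := unliftP ord_max i; rewrite ?ord_rcons_lift ?ord_rcons_max.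
Qed.

Section Derivatives.
Variable R : comNzRingType.

(** The chain rule. It is checked on variables and passes to products, hence to monomials, and then
    to linear combinations. *)
Lemma mderiv_comp n k (lq : n.-tuple {mpoly R[k]}) (p : {mpoly R[n]}) i :
  (p \mPo lq)^`M(i) = \sum_(j < n) (p^`M(j) \mPo lq) * (tnth lq j)^`M(i).
Proof.
pose C (q : {mpoly R[n]}) :=
  (q \mPo lq)^`M(i) = \sum_(j < n) (q^`M(j) \mPo lq) * (tnth lq j)^`M(i).
have C1 : C 1.
  rewrite /C comp_mpoly1 -mpolyC1 mderivC big1 // => j _.
  by rewrite mderivC comp_mpoly0 mul0r.
have CM q r : C q -> C r -> C (q * r).
  move=> Cq Cr; rewrite /C rmorphM mderivM Cq Cr mulr_suml mulr_sumr -big_split /=.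
  by apply: eq_bigr => j _; rewrite mderivM rmorphD !rmorphM /=; ring.
have CX j : C 'X_j.
  rewrite /C comp_mpolyXU -tnth_nth (bigD1 j) //= big1 => [|l lj].
    by rewrite mderivX mnm1E eqxx scale1r -{1}[U_(j)%MM]add0m addmK mpolyX0 comp_mpoly1 mul1r addr0.
  by rewrite mderivX mnm1E eq_sym (negbTE lj) scale0r comp_mpoly0 mul0r.
rewrite [p]mpolyE; elim/big_ind: _ => [|q r Cq Cr|m _].
- rewrite comp_mpoly0 mderiv0 big1 // => j _.
  by rewrite mderiv0 comp_mpoly0 mul0r.
- rewrite comp_mpolyD mderivD Cq Cr -big_split; apply: eq_bigr => j _ /=.
  by rewrite mderivD comp_mpolyD mulrDl.
have Cm : C 'X_[m].
  rewrite mpolyXE_id; elim/big_ind: _ => // j _.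
  by elim: (m j) => // e IH; rewrite exprS; apply: CM.
rewrite comp_mpolyZ mderivZ Cm scaler_sumr; apply: eq_bigr => j _.
by rewrite mderivZ comp_mpolyZ scalerAl.
Qed.

Lemma msize_mderiv n (p : {mpoly R[n]}) i : p != 0 -> (msize p^`M(i) < msize p)%N.
Proof.
move=> p0; rewrite -[msize p]prednK ?lt0n ?msize_poly_eq0 // ltnS.
rewrite [leqLHS]msizeE; apply/bigmax_leqP_seq => m mp _.
have : (m + U_(i))%MM \in msupp p.
  rewrite mcoeff_msupp; apply: contraTneq mp => p0m.
  by rewrite mcoeff_msupp mcoeff_mderiv p0m mul0rn eqxx.
by move/msize_mdeg_lt; rewrite mdegD mdeg1 addn1; lia.
Qed.

End Derivatives.

Lemma mderiv_eq0_mnm (F : fieldType) n (p : {mpoly F[n]}) i : char0 F ->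
  p^`M(i) = 0 -> forall m, m \in msupp p -> m i = 0%N.
Proof.
move=> charF p0 m mp; apply/eqP/negPn/negP => mi.
have := congr1 (mcoeff (m - U_(i))%MM) p0.
rewrite mcoeff_mderiv mcoeff0 submK; last first.
  by apply/mnm_lepP => j; rewrite mnm1E; case: eqP => // <-; rewrite lt0n.
rewrite -mulr_natr => /eqP; rewrite mulf_eq0 (negbTE (charF _)) orbF.
by move: mp; rewrite mcoeff_msupp => /negbTE ->.
Qed.

(** * Jacobians and algebraic relations *)

Section SizeBounds.
Variables (F : fieldType) (n : nat).

(** As [msize] is the degree plus one, a bound by [a.+1] says that the degree is at most [a]. *)
Lemma msizeM_leD (p q : {mpoly F[n]}) a b :
  (msize p <= a.+1)%N -> (msize q <= b.+1)%N -> (msize (p * q)%R <= (a + b).+1)%N.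
Proof.
have [->|p0] := eqVneq p 0; first by rewrite mul0r msize0.
have [->|q0] := eqVneq q 0; first by rewrite mulr0 msize0.
by move=> pa qb; rewrite msizeM //; move: (msize p) (msize q) pa qb => sp sq; lia.
Qed.

Lemma msizeX_leM (p : {mpoly F[n]}) a k :
  (msize p <= a.+1)%N -> (msize (p ^+ k)%R <= (k * a).+1)%N.
Proof.
move=> pa; elim: k => [|k IH]; first by rewrite expr0 msize1.
by rewrite exprS mulSn msizeM_leD.
Qed.

Lemma msize_prod_le (I : finType) (p : I -> {mpoly F[n]}) (a : I -> nat) :
  (forall i, (msize (p i) <= (a i).+1)%N) ->
  (msize (\prod_i p i)%R <= (\sum_i a i).+1)%N.
Proof.
move=> pa; pose R (q : {mpoly F[n]}) b := (msize q <= b.+1)%N.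
apply: (big_ind2 R) => [|q b q' b' qb qb'|i _]; [by rewrite /R msize1| |exact: pa].
exact: msizeM_leD.
Qed.

End SizeBounds.

(** With [m = ((n.+1 * e).+1 ^ n).+1], the monomials in [n.+1] variables with exponents below [m]
    have degree at most [n.+1 * m]; the outer successor turns this into an [msize]. *)
Definition relation_bound (n e : nat) : nat :=
  (n.+1 * ((n.+1 * e).+1 ^ n).+1).+1.

(* Dimension count: there are [m ^ n.+1] monomials of the [w i] with all
   exponents below [m], and they lie in the span of [r ^ n] monomials. *)
Lemma exists_relation (F : fieldType) (n e : nat) (w : 'I_n.+1 -> {mpoly F[n]}) :
    (forall i, (msize (w i) <= e.+1)%N) ->
  exists P : {mpoly F[n.+1]}, [/\ P != 0, (msize P <= relation_bound n e)%N &
    P \mPo [tuple w i | i < n.+1] = 0].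
Proof.
move=> we; set m := ((n.+1 * e).+1 ^ n).+1.
pose r := (n.+1 * m * e).+1.
pose D : finType := {ffun 'I_n.+1 -> 'I_m}.
pose E : finType := {ffun 'I_n -> 'I_r}.
pose mD (a : D) : 'X_{1..n.+1} := [multinom (a i : nat) | i < n.+1].
pose mE (b : E) : 'X_{1..n} := [multinom (b i : nat) | i < n].
pose W (a : D) := \prod_i w i ^+ a i.
have mDle a : (mdeg (mD a) <= n.+1 * m)%N.
  rewrite mdegE -[X in (X * m)%N]card_ord -sum_nat_const.
  by apply: leq_sum => i _; rewrite mnmE ltnW.
have Wr a : (msize (W a) <= r)%N.
  apply: (leq_trans (msize_prod_le (a := fun i => (a i * e)%N) _)).
    by move=> i; apply: msizeX_leM.
  rewrite ltnS -big_distrl /= leq_mul2r; apply/orP; right.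
  by apply: leq_trans (mDle a); rewrite mdegE; apply: leq_sum => i _; rewrite mnmE.
pose M : 'M[F]_(#|D|, #|E|) :=
  \matrix_(a, b) (W (enum_val a))@_(mE (enum_val b)).
(* Since [r <= m * (n.+1 * e).+1], the power [r ^ n] is at most [m ^ n * (n.+1 * e).+1 ^ n], and the
   second factor is [m.-1]. *)
have cardlt : (#|E| < #|D|)%N.
  rewrite !card_ffun !card_ord expnS.
  have le_r : (r <= m * (n.+1 * e).+1)%N.
    rewrite /r mulnS (mulnC n.+1) -mulnA ltnS.
    by rewrite -[(m * (n.+1 * e))%N]add0n -addSn leq_add2r.
  apply: (@leq_ltn_trans (m ^ n * (n.+1 * e).+1 ^ n)).
    by rewrite -expnMn; elim: {1 3}n => // k IH; rewrite !expnS leq_mul.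
  by rewrite mulnC ltn_mul2r expn_gt0 /= ltnSn.
have : kermx M != 0.
  rewrite kermx_eq0 /row_free; apply: contraTneq cardlt => rM.
  by rewrite -leqNgt -rM rank_leq_col.
move=> /rowV0Pn[u /sub_kermxP uM u0].
pose P : {mpoly F[n.+1]} := \sum_a u 0 a *: 'X_[mD (enum_val a)].
have mD_inj : injective mD.
  by move=> a a' /mnmP eaa; apply/ffunP => i; apply/val_inj; have := eaa i; rewrite !mnmE.
exists P; split.
- apply: contraNneq u0 => P0; apply/eqP/rowP => a; rewrite mxE.
  have := congr1 (mcoeff (mD (enum_val a))) P0.
  rewrite mcoeff0 raddf_sum /= (bigD1 a) //= mcoeffZ mcoeffX eqxx mulr1.
  rewrite big1 ?addr0 // => a' a'a; rewrite mcoeffZ mcoeffX.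
  by rewrite (inj_eq mD_inj) (inj_eq enum_val_inj) (negbTE a'a) mulr0.
- apply: (leq_trans (mmeasure_sum _ _ _ _)); apply/bigmax_leqP => a _.
  by apply: (leq_trans (msizeZ_le _ _)); rewrite msizeX ltnS.
- have -> : P \mPo [tuple w i | i < n.+1] = \sum_a u 0 a *: W (enum_val a).
    rewrite raddf_sum; apply: eq_bigr => a _ /=; rewrite comp_mpolyZ comp_mpolyX.
    by congr (_ *: _); apply: eq_bigr => i _; rewrite tnth_mktuple mnmE.
  apply/mpolyP => b; rewrite mcoeff0 raddf_sum /=.
  have [lt_br|le_rb] := ltnP (mdeg b) r; last first.
    rewrite big1 // => a _; rewrite mcoeffZ.
    rewrite (_ : _@_b = 0) ?mulr0 //; apply/eqP; rewrite mcoeff_eq0.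
    by apply: msize_mdeg_ge; apply: leq_trans le_rb.
  have bir i : (b i < r)%N.
    by apply: leq_ltn_trans lt_br; rewrite mdegE (bigD1 i) //= leq_addr.
  pose bE : E := [ffun i => Ordinal (bir i)].
  have eb : mE bE = b by apply/mnmP => i; rewrite mnmE ffunE.
  have := congr1 (fun v : 'rV_#|E| => v 0 (enum_rank bE)) uM.
  rewrite !mxE => uM0; rewrite -[RHS]uM0; apply: eq_bigr => a _.
  by rewrite !mxE enum_rankK eb mcoeffZ.
Qed.

Section Jacobian.
Variables (F : fieldType) (n : nat).
Hypothesis charF : char0 F.

Definition jacobian (z : 'I_n -> {mpoly F[n]}) : 'M[{mpoly F[n]}]_n :=
  \matrix_(k, i) (z k)^`M(i).

(** Differentiating a relation gives a row vector killed by the Jacobian matrix. Multiplying by the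
    adjugate shows that every partial derivative of [P] is again a relation, of smaller degree and
    so zero by induction. Thus [P] is constant, and the relation makes it 0. *)
Lemma jacobian_indep (z : 'I_n -> {mpoly F[n]}) (P : {mpoly F[n]}) :
  \det (jacobian z) != 0 -> P \mPo [tuple z k | k < n] = 0 -> P = 0.
Proof.
move=> detJ; elim: {P}(msize P).+1 {-2}P (ltnSn (msize P)) => // e IH P ltPe Pz.
apply/eqP/negPn/negP => P0.
pose v : 'rV[{mpoly F[n]}]_n := \row_k (P^`M(k) \mPo [tuple z k | k < n]).
have vJ : v *m jacobian z = 0.
  apply/rowP => i; transitivity (P \mPo [tuple z k | k < n])^`M(i); last first.
    by rewrite Pz mderiv0 mxE.
  rewrite mxE mderiv_comp.
  by apply: eq_bigr => k _; rewrite !mxE tnth_mktuple.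
have v0 : v = 0.
  have := congr1 (mulmx^~ (\adj (jacobian z))) vJ.
  rewrite -mulmxA mul_mx_adj mul_mx_scalar mul0mx => /rowP vk; apply/rowP => k.
  by have /eqP := vk k; rewrite !mxE mulf_eq0 (negbTE detJ) => /eqP.
have dP k : P^`M(k) = 0.
  apply: IH; first by apply: leq_trans (msize_mderiv k P0) _.
  by have /rowP/(_ k) := v0; rewrite !mxE.
have PC : P = (P@_0)%:MP.
  apply/mpolyP => m; rewrite mcoeffC; case: eqVneq => [->|m0]; rewrite ?mulr1 ?mulr0 //.
  apply/eqP; rewrite mcoeff_eq0; apply: contraNN m0 => mP; apply/eqP/mnmP => k.
  by rewrite mnm0E; apply: (mderiv_eq0_mnm charF (dP k)).
by move: Pz P0; rewrite PC comp_mpolyC => ->; rewrite eqxx.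
Qed.

(* Cramer's rule expresses [\det J *: grad y] through the gradients of [z]
   with coefficients the determinants below. *)
Lemma relation_mderiv (z : 'I_n -> {mpoly F[n]}) (y : {mpoly F[n]})
    (P : {mpoly F[n.+1]}) (k : 'I_n) :
  \det (jacobian z) != 0 ->
  \det (jacobian (fun l => if l == k then y else z l)) = 0 ->
  P \mPo [tuple ord_rcons z y i | i < n.+1] = 0 ->
  P^`M(lift ord_max k) \mPo [tuple ord_rcons z y i | i < n.+1] = 0.
Proof.
move=> detJ detk Pw; set w := [tuple _ | i < n.+1] in Pw *.
pose v : 'rV[{mpoly F[n]}]_n := \row_k (P^`M(lift ord_max k) \mPo w).
pose g : 'rV[{mpoly F[n]}]_n := \row_i y^`M(i).
pose c := P^`M(ord_max) \mPo w.
have vJ : v *m jacobian z + c *: g = 0.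
  apply/rowP => i; transitivity (P \mPo w)^`M(i); last by rewrite Pw mderiv0 mxE.
  rewrite !mxE mderiv_comp.
  rewrite (bigD1_ord ord_max) //= tnth_mktuple ord_rcons_max addrC; congr (_ + _).
  by apply: eq_bigr => l _; rewrite !mxE tnth_mktuple ord_rcons_lift.
have gk : (g *m \adj (jacobian z)) 0 k = 0.
  rewrite -detk (expand_det_row _ k) mxE; apply: eq_bigr => i _.
  rewrite !mxE eqxx; congr (_ * (_ * \det _)); apply/matrixP => a b.
  by rewrite !mxE eq_sym (negbTE (neq_lift _ _)).
have := congr1 (fun A => (A *m \adj (jacobian z)) 0 k) vJ.
rewrite mulmxDl -mulmxA mul_mx_adj mul_mx_scalar -scalemxAl mul0mx.
rewrite [X in X = _]mxE [X in _ + X]mxE gk mulr0 addr0 !mxE => /eqP.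
by rewrite mulf_eq0 (negbTE detJ) => /eqP.
Qed.

(** As long as some partial derivative in a direction of [S] is nonzero, replace [P] by it: it is
    still a relation and has smaller degree. In characteristic 0 the final [Q] is free of the
    variables in [S]. *)
Lemma relation_descent (z : 'I_n -> {mpoly F[n]}) (y : {mpoly F[n]}) (S : pred 'I_n)
    (P : {mpoly F[n.+1]}) :
  \det (jacobian z) != 0 ->
  (forall k, S k -> \det (jacobian (fun l => if l == k then y else z l)) = 0) ->
  P != 0 -> P \mPo [tuple ord_rcons z y i | i < n.+1] = 0 ->
  exists Q : {mpoly F[n.+1]}, [/\ Q != 0, (msize Q <= msize P)%N,
    Q \mPo [tuple ord_rcons z y i | i < n.+1] = 0 &
    forall k, S k -> Q^`M(lift ord_max k) = 0].
Proof.
move=> detJ detS.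
elim: {P}(msize P).+1 {-2}P (ltnSn (msize P)) => // e IH P ltPe P0 Pw.
have [dP|/existsNP[k /not_implyP[Sk /eqP dk]]] :=
  pselect (forall k, S k -> P^`M(lift ord_max k) = 0); first by exists P; split.
have ltk := msize_mderiv (lift ord_max k) P0.
have [||Q [Q0 Qle Qw dQ]] := IH _ _ dk; first exact: leq_trans ltk _.
  exact: relation_mderiv (detS _ Sk) Pw.
by exists Q; split=> //; apply: leq_trans Qle (ltnW ltk).
Qed.

(** Here [s k = None] keeps the source coordinate ['X_k]. The all-[None] choice has identity
    Jacobian; in a choice with the most [y] coordinates, no further replacement keeps the
    determinant nonzero. *)
Lemma maximal_jacobian (J : finType) (y : J -> {mpoly F[n]}) :
  exists s : 'I_n -> option J, let z k := oapp y 'X_k (s k) in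
    \det (jacobian z) != 0 /\
    forall j k, s k = None ->
      \det (jacobian (fun l => if l == k then y j else z l)) = 0.
Proof.
pose z (s : {ffun 'I_n -> option J}) k := oapp y 'X_k (s k).
pose A := [pred s | \det (jacobian (z s)) != 0].
have A0 : A [ffun=> None].
  rewrite /A /= (_ : jacobian _ = 1%:M) ?det1 ?oner_neq0 //.
  apply/matrixP => k i; rewrite !mxE /z ffunE /= mderivX mnm1E eq_sym.
  have [->|] := eqVneq k i; last by rewrite scale0r.
  by rewrite scale1r -{1}[U_(i)%MM]add0m addmK mpolyX0.
case: (arg_maxnP (fun s : {ffun 'I_n -> option J} => #|[set k | s k]|) A0) => s As smax.
exists s; split=> // j k sk; apply/eqP/negPn/negP => detk.
pose s' : {ffun 'I_n -> option J} := [ffun l => if l == k then Some j else s l].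
have zs' : (fun l => if l == k then y j else z s l) =1 z s'.
  by move=> l; rewrite /z ffunE; case: eqP.
have As' : A s'.
  rewrite /A /=; apply: contraNneq detk => d0; rewrite -d0; apply/eqP; congr (\det _).
  by apply/matrixP => a b; rewrite !mxE zs'.
have : (#|[set k | s' k]| <= #|[set k | s k]|)%N := smax s' As'.
rewrite leqNgt; case/negP; apply: proper_card.
apply/properP; split; last by exists k; rewrite inE ?ffunE ?eqxx ?sk.
by apply/fintype.subsetP => l; rewrite !inE ffunE; case: eqP.
Qed.

End Jacobian.

(** * Points of bounded degree on Galois-stable images *)

Section GenericImage.
Variables (F : closedFieldType) (n : nat).

Lemma nth_tuple_of (t : 'I_n -> F) (i : 'I_n) : [seq t k | k <- enum 'I_n]`_i = t i.
Proof. by rewrite (nth_map i) ?size_enum_ord // nth_ord_enum. Qed.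

(** Variables are shifted by [n]: in the formulas below, indices under [n] hold the target point and
    the next [n] hold the source point. *)
Definition mpoly_term (p : {mpoly F[n]}) : GRing.term F :=
  foldr (fun m u => GRing.Add (GRing.Mul (GRing.Const p@_m)
    (foldr (fun i v => GRing.Mul (GRing.Exp (GRing.Var F (n + val i)) (m i)) v)
       (GRing.Const 1) (index_enum 'I_n))) u) (GRing.Const 0) (msupp p).

Lemma eval_mpoly_term (e : seq F) p :
  GRing.eval e (mpoly_term p) = p.@[fun i => e`_(n + i)].
Proof.
rewrite mevalE /mpoly_term; elim: (msupp p : seq _) => [|m ms IH] /=.
  by rewrite big_nil.
rewrite big_cons -IH; congr (_ * _ + _).
by elim: (index_enum _) => [|i r IHr] /=; rewrite ?big_nil // big_cons IHr.
Qed.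

Lemma rterm_mpoly_term p : GRing.rterm (mpoly_term p).
Proof.
rewrite /mpoly_term; elim: (msupp p : seq _) => [|m ms IH] //=; rewrite IH andbT.
by elim: (index_enum _) => [|i r IHr].
Qed.

Lemma rterm_mpoly (u : GRing.term F) : GRing.rterm u ->
  exists p : {mpoly F[n]}, forall t : 'I_n -> F, GRing.eval [seq t i | i <- enum 'I_n] u = p.@[t].
Proof.
elim: u => //=.
- move=> i _; have [lti|lei] := ltnP i n.
    exists 'X_(Ordinal lti) => t; rewrite mevalXU.
    exact: (nth_tuple_of t (Ordinal lti)).
  (* A variable beyond the environment evaluates to the default 0. *)
  by exists 0 => t; rewrite meval0 nth_default // size_map size_enum_ord.
- by move=> c _; exists c%:MP => t; rewrite mevalC.
- by move=> k _; exists (k%:R)%:MP => t; rewrite mevalC.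
- move=> u IHu v IHv /andP[/IHu[p pE] /IHv[q qE]].
  by exists (p + q) => t; rewrite pE qE mevalD.
- by move=> u IHu /IHu[p pE]; exists (- p) => t; rewrite pE mevalN.
- by move=> u IHu k /IHu[p pE]; exists (p *+ k) => t; rewrite pE mevalMn.
- move=> u IHu v IHv /andP[/IHu[p pE] /IHv[q qE]].
  by exists (p * q) => t; rewrite pE qE mevalM.
- by move=> u IHu k /IHu[p pE]; exists (p ^+ k) => t; rewrite pE rmorphXn.
Qed.

(** An atom [p = q] holds identically or fails wherever [p - q] is nonzero. Connectives multiply the
    exceptional polynomials. *)
Lemma qf_generically_constant (f : GRing.formula F) :
  GRing.qf_form f -> GRing.rformula f ->
  exists (h : {mpoly F[n]}) (b : bool), h != 0 /\
    forall t : 'I_n -> F, h.@[t] != 0 -> GRing.qf_eval [seq t i | i <- enum 'I_n] f = b.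
Proof.
have binop (o : bool -> bool -> bool) (f1 f2 : seq F -> bool) :
    (exists (h : {mpoly F[n]}) (b : bool), h != 0 /\
      forall t : 'I_n -> F, h.@[t] != 0 -> f1 [seq t i | i <- enum 'I_n] = b) ->
    (exists (h : {mpoly F[n]}) (b : bool), h != 0 /\
      forall t : 'I_n -> F, h.@[t] != 0 -> f2 [seq t i | i <- enum 'I_n] = b) ->
    exists (h : {mpoly F[n]}) (b : bool), h != 0 /\
      forall t : 'I_n -> F, h.@[t] != 0 ->
        o (f1 [seq t i | i <- enum 'I_n]) (f2 [seq t i | i <- enum 'I_n]) = b.
  move=> [h1 [b1 [h10 h1P]]] [h2 [b2 [h20 h2P]]].
  exists (h1 * h2), (o b1 b2); rewrite mulf_neq0 //; split=> // t.
  by rewrite mevalM mulf_eq0 negb_or => /andP[/h1P -> /h2P ->].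
elim: f => //=.
- by move=> b _ _; exists 1, b; rewrite oner_neq0.
- move=> u v _ /andP[/rterm_mpoly[p pE] /rterm_mpoly[q qE]].
  have [epq|pq] := eqVneq p q.
    by exists 1, true; rewrite oner_neq0; split=> // t _; rewrite pE qE epq eqxx.
  exists (p - q), false; rewrite subr_eq0; split=> // t.
  by rewrite pE qE mevalB subr_eq0 => /negbTE.
- move=> f1 IH1 f2 IH2 /andP[q1 q2] /andP[r1 r2].
  exact: (binop andb (fun e => GRing.qf_eval e f1)
    (fun e => GRing.qf_eval e f2) (IH1 q1 r1) (IH2 q2 r2)).
- move=> f1 IH1 f2 IH2 /andP[q1 q2] /andP[r1 r2].
  exact: (binop orb (fun e => GRing.qf_eval e f1)
    (fun e => GRing.qf_eval e f2) (IH1 q1 r1) (IH2 q2 r2)).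
- move=> f1 IH1 f2 IH2 /andP[q1 q2] /andP[r1 r2].
  exact: (binop implb (fun e => GRing.qf_eval e f1)
    (fun e => GRing.qf_eval e f2) (IH1 q1 r1) (IH2 q2 r2)).
- move=> f1 IH1 q1 r1; have [h [b [h0 hP]]] := IH1 q1 r1.
  by exists h, (~~ b); split=> // t /hP ->.
Qed.

(* Quantifier elimination makes "[t] is in the image" either generically true
   or generically false; independence of [z] excludes the second case. *)
Lemma image_generic (z : 'I_n -> {mpoly F[n]}) (g : {mpoly F[n]}) :
  char0 F -> g != 0 ->
  (forall P : {mpoly F[n]}, P \mPo [tuple z k | k < n] = 0 -> P = 0) ->
  exists2 h : {mpoly F[n]}, h != 0 &
    forall t : 'I_n -> F, h.@[t] != 0 ->
    exists2 x : 'I_n -> F, g.@[x] != 0 & forall k, (z k).@[x] = t k.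
Proof.
move=> charF g0 zindep.
pose eqs := foldr (fun k f => GRing.And
  (GRing.Equal (mpoly_term (z k)) (GRing.Var F (val k))) f) (GRing.Bool true) (index_enum 'I_n).
pose body := GRing.And eqs (GRing.Not (GRing.Equal (mpoly_term g) (GRing.Const 0))).
pose f := foldr (@GRing.Exists F) body (iota n n).
have rf : GRing.rformula f.
  have rb : GRing.rformula body.
    rewrite /= rterm_mpoly_term /= andbT /eqs.
    by elim: (index_enum _) => //= k r ->; rewrite rterm_mpoly_term.
  by rewrite /f; elim: (iota n n) => //=.
have bodyP e : GRing.holds e body <->
    (forall k : 'I_n, (z k).@[fun i => e`_(n + i)] = e`_k) /\ g.@[fun i => e`_(n + i)] != 0.
  rewrite /= !eval_mpoly_term.
  have -> : (g.@[fun i => e`_(n + i)] != 0) <-> (g.@[fun i => e`_(n + i)] <> 0).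
    by split => /eqP.
  have -> : GRing.holds e eqs <-> (forall k : 'I_n, (z k).@[fun i => e`_(n + i)] = e`_k).
    rewrite /eqs; have : index_enum 'I_n =i predT by move=> k; rewrite mem_index_enum.
    move: (index_enum _) => r rT.
    have -> : (forall k : 'I_n, (z k).@[fun i => e`_(n + i)] = e`_k) <->
        (forall k : 'I_n, k \in r -> (z k).@[fun i => e`_(n + i)] = e`_k).
      by split=> h k => [_|]; apply: h; rewrite rT.
    elim: r {rT} => [|k r IH] //=; rewrite eval_mpoly_term IH; split.
      by move=> [zk zr] l; rewrite inE => /predU1P[->|/zr].
    by move=> h; split=> [|l lr]; apply: h; rewrite inE ?eqxx ?lr ?orbT.
  by [].
have fP (t : 'I_n -> F) : GRing.holds [seq t i | i <- enum 'I_n] f <->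
    exists2 x : 'I_n -> F, g.@[x] != 0 & forall k, (z k).@[x] = t k.
  rewrite /f -GRing.foldExistsP; split.
    move=> [e et /bodyP[zE gE]]; exists (fun i => e`_(n + i)) => // k.
    rewrite zE -et ?nth_tuple_of // inE mem_iota.
    by rewrite negb_and -ltnNge ltn_ord.
  move=> [x gx zx]; exists ([seq t i | i <- enum 'I_n] ++ [seq x i | i <- enum 'I_n]).
    move=> i; rewrite inE mem_iota nth_cat size_map size_enum_ord negb_and -ltnNge -leqNgt.
    case: ltnP => //= ni le2.
    have le3 : (n <= i - n)%N by rewrite leq_subRL.
    by rewrite !nth_default // size_map size_enum_ord.
  apply/bodyP; have ex : (fun i : 'I_n =>
      ([seq t i | i <- enum 'I_n] ++ [seq x i | i <- enum 'I_n])`_(n + i)) =1 x.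
    move=> i; rewrite nth_cat size_map size_enum_ord ltnNge leq_addr /= addKn.
    exact: nth_tuple_of.
  split=> [k|]; last by rewrite (meval_eq _ ex).
  by rewrite (meval_eq _ ex) nth_cat size_map size_enum_ord ltn_ord nth_tuple_of.
pose qf := GRing.quantifier_elim (@closed_field.ClosedFieldQE.ex_elim F) f.
have qfP (t : 'I_n -> F) : reflect
    (GRing.holds [seq t i | i <- enum 'I_n] f) (GRing.qf_eval [seq t i | i <- enum 'I_n] qf).
  apply: GRing.quantifier_elim_rformP => //.
    exact: closed_field.ClosedFieldQE.wf_ex_elim.
  exact: closed_field.ClosedFieldQE.holds_ex_elim (@GRing.solve_monicpoly F).
have /andP[qfq qfr] : GRing.qf_form qf && GRing.rformula qf.
  exact: GRing.quantifier_elim_wf (@closed_field.ClosedFieldQE.wf_ex_elim F) _ rf.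
have [h [b [h0 hb]]] := qf_generically_constant qfq qfr.
exists h => // t ht; apply/fP/qfP; rewrite hb //; case: b hb => // hb.
(* Suppose the image is generically avoided. Independence of [z] provides [x] with [h] nonzero at
   [z(x)] and [g.@[x] != 0], yet [z(x)] is in the image. *)
have hz0 : h \mPo [tuple z k | k < n] != 0 by apply: contraNneq h0 => /zindep ->.
have [x] := mpoly_nonroot_nat charF (mulf_neq0 hz0 g0).
rewrite mevalM mulf_eq0 negb_or comp_mpoly_meval => /andP[hx gx].
case/qfP: (hb _ hx); apply/fP; exists (fun i => (x i)%:R) => // k.
by rewrite tnth_mktuple.
Qed.

End GenericImage.

Theorem bounded_degree_point (n e : nat) (J : finType) (F : closedFieldType)
    (K : pred F) (y : J -> {mpoly F[n]}) (g : {mpoly F[n]}) :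
    char0 F -> is_subfield K -> algebraic_over K ->
    (forall j, (msize (y j) <= e.+2)%N) -> g != 0 ->
    (forall (sigma : {rmorphism F -> F}) (x : 'I_n -> F), in_Gal K sigma -> g.@[x] != 0 ->
       exists2 x' : 'I_n -> F, g.@[x'] != 0 & forall j, sigma (y j).@[x] = (y j).@[x']) ->
  exists (x : 'I_n -> F) (L : pred F), g.@[x] != 0 /\
    [/\ is_subfield L, forall a, a \in K -> a \in L, forall j, (y j).@[x] \in L &
      degree_le K L ((relation_bound n e.+1).-1 ^ #|J|)].
Proof.
move=> charF subK algK ye g0 stable.
have [s [detJ detS]] := maximal_jacobian y.
set z := (fun k => oapp y 'X_k (s k)) in detJ detS.
(* The bound [e.+2] leaves room for a source coordinate, whose [msize] is 2. *)
have ze k : (msize (z k) <= e.+2)%N.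
  by rewrite /z; case: (s k) => [j|] /=; [exact: ye | rewrite msizeX mdeg1].
have /choice[P PP] : forall j, exists P : {mpoly F[n.+1]}, [/\ P != 0,
    (msize P <= relation_bound n e.+1)%N, P \mPo [tuple ord_rcons z (y j) i | i < n.+1] = 0 &
    forall k, s k = None -> P^`M(lift ord_max k) = 0].
  move=> j.
  have [i|P [P0 Ple Pw]] := @exists_relation F n e.+1 (ord_rcons z (y j)).
    by have [k ->|->] := unliftP ord_max i; rewrite ?ord_rcons_lift ?ord_rcons_max.
  have detS' k : s k == None -> \det (jacobian (fun l => if l == k then y j else z l)) = 0.
    by move=> /eqP; apply: detS.
  have [Q [Q0 Qle Qw dQ]] := relation_descent detJ detS' P0 Pw.
  exists Q; split=> //; first exact: leq_trans Ple.
  by move=> k sk; apply: dQ; rewrite sk.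
have [h h0 himg] := image_generic charF g0 (fun P => jacobian_indep charF detJ).
(* Viewing [h] in [n.+1] variables lets one point avoid the zeros of [h] and of all [P j] at
   once. *)
pose h' : {mpoly F[n.+1]} := h \mPo [tuple 'X_(lift ord_max i) | i < n].
have h'E t a : h'.@[ord_rcons t a] = h.@[t].
  rewrite comp_mpoly_meval; apply: meval_eq => i.
  by rewrite tnth_mktuple mevalXU ord_rcons_lift.
have h'0 : h' != 0.
  have [t ht] := mpoly_nonroot_nat charF h0.
  by apply: contraNneq ht => h'0; rewrite -(h'E _ 0) h'0 meval0.
have H0 : h' * \prod_j P j != 0.
  by rewrite mulf_neq0 //; apply/prodf_neq0 => j _; have [] := PP j.
have [u] := mpoly_nonroot_nat charF H0.
(* [t] is the value prescribed for [z]; [a] certifies that each [P j] stays nonzero once its first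
   [n] variables are set to [t]. *)
pose t k : F := (u (lift ord_max k))%:R; pose a : F := (u ord_max)%:R.
rewrite (@meval_eq _ _ _ (ord_rcons t a)); last first.
  by move=> i; have [k ->|->] := unliftP ord_max i; rewrite ?ord_rcons_lift ?ord_rcons_max.
rewrite mevalM mulf_eq0 negb_or h'E rmorph_prod => /andP[ht /prodf_neq0 Pt].
have [x gx zx] := himg _ ht.
exists x.
have deg j : exists q : {poly F}, [/\ q != 0, (forall i, q`_i \in K), root q (y j).@[x] &
    (size q <= relation_bound n e.+1)%N].
  have [P0 Ple Pw dP] := PP j.
  pose p := map_poly (meval t) (muni (P j)).
  have p0 : p != 0.
    by have := Pt j isT; rewrite /= meval_muni -/p; apply: contraNneq => ->; rewrite horner0.
  (* Evaluate the relation [P j] at [x']. Where [s k = Some l], the value of [z k] at [x'] is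
     [sigma (t k) = t k], as [t k] is a natural number; where [s k = None], that variable does not
     occur in [P j]. *)
  have pv sigma : in_Gal K sigma -> root p (sigma (y j).@[x]).
    move=> sG; have [x' _ yx'] := stable sigma x sG gx.
    rewrite yx'; apply/rootP; rewrite /p -meval_muni.
    transitivity ((P j \mPo [tuple ord_rcons z (y j) i | i < n.+1]).@[x']); last first.
      by rewrite Pw meval0.
    rewrite comp_mpoly_meval !mevalE big_seq [RHS]big_seq; apply: eq_bigr => m mP.
    congr (_ * _); apply: eq_bigr => i _; rewrite tnth_mktuple.
    have [k ->|->] := unliftP ord_max i; rewrite ?ord_rcons_lift ?ord_rcons_max //.
    case sk : (s k) => [l|]; last by rewrite (mderiv_eq0_mnm charF (dP _ sk) mP) !expr0.
    rewrite /z sk /= -yx'; have -> : (y l).@[x] = t k by rewrite -zx /z sk.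
    by case: sG => _ ->  //; apply: subfield_nat.
  have [q [q0 qK qv qle]] := Gal_orbit_degree subK algK charF p0 pv.
  exists q; split=> //; apply: (leq_trans qle); apply: leq_trans Ple.
  by apply: leq_trans (size_muni _); apply: size_poly.
have [v /mapP[j _ ->]|L [subL KL yL dL]] := @adjoin_algebraic_seq F K
    (relation_bound n e.+1).-1 [seq (y j).@[x] | j <- enum J] subK algK.
  by have [q [q0 qK qv qle]] := deg j; exists q.
exists L; split=> //; split=> //.
  by move=> j; apply: yL; apply: map_f; rewrite mem_enum.
by move: dL; rewrite size_map -cardE.
Qed.

(** * The conjugacy orbit of an endomorphism *)

Section UniversalCoefficients.
Variables (k : nat) (R : comNzRingType).

(** The coefficient at [m] of the monomial [m'] after the linear substitution [A]. A general ring of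
    entries allows generic matrices. *)
Definition subst_coef (A : 'M[R]_k) (m' m : 'X_{1..k}) : R :=
  (\prod_(l < k) (\sum_(q < k) A l q *: 'X_q) ^+ m' l : {mpoly R[k]})@_m.

Definition adj_subst_coef (A : 'M[R]_k) (i j : 'I_k) (m' m : 'X_{1..k}) : R :=
  \adj A i j * subst_coef A m' m.

End UniversalCoefficients.

(** Naturality in the ring serves twice: for specialising the generic matrix and for applying a
    Galois automorphism. *)
Lemma adj_subst_coef_map (k : nat) (R S : comNzRingType) (h : {rmorphism R -> S})
    (A : 'M[R]_k) i j m' m :
  h (adj_subst_coef A i j m' m) = adj_subst_coef (map_mx h A) i j m' m.
Proof.
rewrite /adj_subst_coef rmorphM -map_mx_adj [in RHS]mxE; congr (_ * _).
rewrite /subst_coef -mcoeff_map_mpoly; congr (_@__); rewrite rmorph_prod.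
apply: eq_bigr => l _; rewrite rmorphXn /= raddf_sum; congr (_ ^+ _).
by apply: eq_bigr => q _; rewrite /= map_mpolyZ map_mpolyX mxE.
Qed.

Definition generic_mx (k : nat) (R : comNzRingType) : 'M[{mpoly R[k * k]}]_k :=
  \matrix_(i, j) 'X_(mxvec_index i j).

Definition vec_to_mx (k : nat) (R : Type) (x : 'I_(k * k) -> R) : 'M[R]_k :=
  \matrix_(i, j) x (mxvec_index i j).

Lemma vec_to_mx_surj (k : nat) (R : Type) (A : 'M[R]_k) :
  exists x : 'I_(k * k) -> R, vec_to_mx x = A.
Proof.
by exists (fun l => mxvec A 0 l); apply/matrixP => i j; rewrite mxE mxvecE.
Qed.

Lemma msize_map_mpoly (n : nat) (R S : comNzRingType) (h : {rmorphism R -> S})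
  (p : {mpoly R[n]}) : (msize (map_mpoly h p) <= msize p)%N.
Proof.
rewrite [leqLHS]msizeE; apply/bigmax_leqP_seq => m mp _; apply: msize_mdeg_lt.
move: mp; rewrite !mcoeff_msupp mcoeff_map_mpoly.
by apply: contraNneq => ->; rewrite raddf0.
Qed.

Section Conjugation.
Variables (F : fieldType) (N d : nat).
Implicit Types (A B : 'M[F]_N.+1) (f : poly_tuple F N).

Definition homog_tuple f : Prop := forall i, f i \is d.-homog.

Lemma homog_tuple_msize f i : homog_tuple f -> (msize (f i) <= d.+1)%N.
Proof.
move=> /(_ i)/dhomogP fi; rewrite msizeE; apply/bigmax_leqP_seq => m mf _.
by have := fi m mf => /= ->.
Qed.

Lemma lin_formsE A l : tnth (lin_forms A) l = \sum_(q < N.+1) A l q *: 'X_q.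
Proof. by rewrite tnth_mktuple. Qed.

Lemma comp_lin_forms A B (p : {mpoly F[N.+1]}) :
  (p \mPo lin_forms B) \mPo lin_forms A = p \mPo lin_forms (B *m A).
Proof.
rewrite [p \mPo _]comp_mpolyE [RHS]comp_mpolyE raddf_sum; apply: eq_bigr => m _ /=.
rewrite comp_mpolyZ rmorph_prod; congr (_ *: _); apply: eq_bigr => l _ /=.
rewrite rmorphXn; congr (_ ^+ _); rewrite !lin_formsE raddf_sum /=.
transitivity (\sum_(j < N.+1) \sum_(q < N.+1) (B l j * A j q) *: ('X_q : {mpoly F[N.+1]})).
  apply: eq_bigr => j _; rewrite comp_mpolyZ comp_mpolyXU -tnth_nth lin_formsE scaler_sumr.
  by apply: eq_bigr => q _; rewrite scalerA.
rewrite exchange_big; apply: eq_bigr => q _ /=.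
by rewrite mxE scaler_suml.
Qed.

Lemma conj_endoM A B f i : A \in unitmx -> B \in unitmx ->
  conj_endo A (conj_endo B f) i = conj_endo (B *m A) f i.
Proof.
move=> Au Bu; have BAu : B *m A \in unitmx by rewrite unitmx_mul Bu.
have -> : conj_endo (B *m A) f i =
    \sum_(j < N.+1) (invmx A *m invmx B) i j *: (f j \mPo lin_forms (B *m A)).
  apply: eq_bigr => j _; congr (fun_of_matrix _ _ _ *: _).
  apply: (can_inj (mulKmx BAu)); rewrite mulmxV // mulmxA -(mulmxA B) mulmxV //.
  by rewrite mulmx1 mulmxV.
rewrite /conj_endo.
transitivity (\sum_(j < N.+1) \sum_(l < N.+1)
    (invmx A i j * invmx B j l) *: (f l \mPo lin_forms (B *m A))).
  apply: eq_bigr => j _; rewrite (raddf_sum (comp_mpoly (lin_forms A))) scaler_sumr.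
  apply: eq_bigr => l _ /=.
  by rewrite comp_mpolyZ scalerA comp_lin_forms.
rewrite exchange_big; apply: eq_bigr => l _ /=.
by rewrite mxE scaler_suml.
Qed.

Lemma conj_endo_scalef A f c i :
  conj_endo A (fun j => c *: f j) i = c *: conj_endo A f i.
Proof.
rewrite /conj_endo scaler_sumr; apply: eq_bigr => j _.
by rewrite comp_mpolyZ !scalerA mulrC.
Qed.

(** The inverse matrix contributes [c^-1] and homogeneity of degree [d] contributes [c ^+ d]. *)
Lemma conj_endo_scalemx A f c i : homog_tuple f -> c != 0 -> A \in unitmx ->
  conj_endo (c *: A) f i = (c^-1 * c ^+ d) *: conj_endo A f i.
Proof.
move=> fh c0 Au; rewrite /conj_endo scaler_sumr; apply: eq_bigr => j _.
rewrite invmxZ ?unitmxZ ?unitfE // [(c^-1 *: invmx A) i j]mxE.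
have -> : f j \mPo lin_forms (c *: A) = c ^+ d *: (f j \mPo lin_forms A).
  rewrite !comp_mpolyE scaler_sumr big_seq [RHS]big_seq; apply: eq_bigr => m mf.
  have /dhomogP/(_ m mf) /= md := fh j.
  rewrite scalerA mulrC -scalerA; congr (_ *: _).
  transitivity (\prod_(l < N.+1) ((c ^+ m l)%:MP * tnth (lin_forms A) l ^+ m l)).
    apply: eq_bigr => l _; rewrite !lin_formsE rmorphXn -exprMn mul_mpolyC scaler_sumr.
    by congr (_ ^+ _); apply: eq_bigr => q _; rewrite mxE scalerA.
  rewrite big_split /= -rmorph_prod mul_mpolyC; congr (_ *: _).
  by rewrite prodrXr -mdegE md.
by rewrite !scalerA; congr (_ *: _); ring.
Qed.

Lemma msize_conj_endo A f i : homog_tuple f -> (msize (conj_endo A f i) <= d.+1)%N.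
Proof.
move=> fh; apply: (leq_trans (mmeasure_sum _ _ _ _)); apply/bigmax_leqP => j _.
apply: (leq_trans (msizeZ_le _ _)).
rewrite comp_mpolyE; apply: (leq_trans (mmeasure_sum _ _ _ _)).
apply/bigmax_leqP_seq => m mf _; apply: (leq_trans (msizeZ_le _ _)).
apply: leq_trans (homog_tuple_msize j fh); apply: leq_trans (msize_mdeg_lt mf).
rewrite mdegE; apply: (msize_prod_le (a := fun l => m l)) => l.
rewrite -[X in (_ <= X.+1)%N]muln1; apply: msizeX_leM.
rewrite lin_formsE; apply: (leq_trans (mmeasure_sum _ _ _ _)).
apply/bigmax_leqP => q _; apply: (leq_trans (msizeZ_le _ _)).
by rewrite msizeX mdeg1.
Qed.

(** Coefficients of adj(A) f(A x): the adjugate replaces the inverse so that they are polynomial in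
    the entries of [A]. *)
Definition orbit_coef A f (i : 'I_N.+1) (m : 'X_{1..N.+1}) : F :=
  \sum_(p : 'I_N.+1 * 'X_{1..N.+1 < d.+1}) (f p.1)@_p.2 * adj_subst_coef A i p.1 p.2 m.

Lemma orbit_coefE A f i m : homog_tuple f -> A \in unitmx ->
  orbit_coef A f i m = (\det A *: conj_endo A f i)@_m.
Proof.
move=> fh Au; rewrite /orbit_coef -(pair_big predT predT
  (fun j (m' : 'X_{1..N.+1 < d.+1}) => (f j)@_m' * adj_subst_coef A i j m' m)) /=.
rewrite /conj_endo scaler_sumr raddf_sum; apply: eq_bigr => j _ /=.
rewrite scalerA mcoeffZ (comp_mpolywE _ (homog_tuple_msize j fh)) raddf_sum mulr_sumr.
apply: eq_bigr => m' _; rewrite /= mcoeffZ mulrCA; congr (_ * (_ * _)).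
  rewrite /invmx Au [((\det A)^-1 *: \adj A) i j]mxE mulrA mulfV ?mul1r //.
  by move: Au; rewrite unitmxE unitfE.
by rewrite /subst_coef; congr (_@__); apply: eq_bigr => l _; rewrite lin_formsE.
Qed.

Lemma orbit_coef_gal (sigma : {rmorphism F -> F}) A f i m :
  sigma (orbit_coef A f i m) = orbit_coef (map_mx sigma A) (gal_act sigma f) i m.
Proof.
rewrite /orbit_coef rmorph_sum; apply: eq_bigr => p _.
by rewrite rmorphM /= adj_subst_coef_map /gal_act mcoeff_map_mpoly.
Qed.

Lemma homog_tuple_gal (sigma : {rmorphism F -> F}) f :
  homog_tuple f -> homog_tuple (gal_act sigma f).
Proof.
move=> fh i; apply/dhomogP => m; rewrite mcoeff_msupp mcoeff_map_mpoly => fm.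
have /dhomogP := fh i; apply; rewrite mcoeff_msupp.
by apply: contraNneq fm => ->; rewrite raddf0.
Qed.

End Conjugation.

Lemma closed_field_root (F : closedFieldType) (n : nat) (c : F) : (0 < n)%N ->
  exists a : F, a ^+ n = c.
Proof.
move=> n0; have : size ('X^n - c%:P) != 1 by rewrite size_XnsubC // eqSS -lt0n.
move=> /closed_rootP[a /rootP]; rewrite !hornerE => /eqP.
by rewrite subr_eq0 => /eqP; exists a.
Qed.

Section Orbit.
Variables (F : closedFieldType) (N d : nat).
Local Notation J := ('I_N.+1 * 'X_{1..N.+1 < d.+1})%type.

(** Integer coefficients make these polynomials, and hence their degrees, independent of the field
    and of [f]. *)
Definition orbit_poly_int (i j : 'I_N.+1) (m' m : 'X_{1..N.+1}) :
  {mpoly int[N.+1 * N.+1]} := adj_subst_coef (generic_mx N.+1 int) i j m' m.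

Definition orbit_poly (f : poly_tuple F N) (q : J) : {mpoly F[N.+1 * N.+1]} :=
  \sum_(p : J) (f p.1)@_p.2 *: map_mpoly intr (orbit_poly_int q.1 p.1 p.2 q.2).

Lemma orbit_polyE f q x :
  (orbit_poly f q).@[x] = orbit_coef d (vec_to_mx x) f q.1 q.2.
Proof.
rewrite raddf_sum; apply: eq_bigr => p _ /=; rewrite mevalZ; congr (_ * _).
apply: etrans (adj_subst_coef_map (meval x \o map_mpoly intr) _ _ _ _ _) _.
congr (adj_subst_coef _ _ _ _ _); apply/matrixP => a b; rewrite !mxE /=.
by rewrite map_mpolyX mevalXU.
Qed.

(** Applying [sigma] conjugates [gal_act sigma f] by the image of [A]; the moduli hypothesis turns
    this into a conjugate of [f] by a product matrix, up to a scalar. *)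
Lemma orbit_stable (K : pred F) (f : poly_tuple F N) (sigma : {rmorphism F -> F})
    (A : 'M[F]_N.+1) :
  (0 < d)%N -> homog_tuple d f -> moduli_in K f -> in_Gal K sigma -> A \in unitmx ->
  exists2 B : 'M[F]_N.+1, B \in unitmx &
    forall i m, sigma (orbit_coef d A f i m) = orbit_coef d B f i m.
Proof.
move=> d0 fh fK sG Au; have [B Bu [c c0 fc]] := fK sigma sG.
have detB0 : \det B != 0 by move: Bu; rewrite unitmxE unitfE.
have sAu : map_mx sigma A \in unitmx by rewrite map_unitmx.
(* [a] absorbs the scalar by which [gal_act sigma f] and [conj_endo B f] differ:
   rescaling the matrix by [a] multiplies [orbit_coef] by [a ^+ (N + d)]. *)
have Nd0 : (0 < N + d)%N by rewrite addn_gt0 d0 orbT.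
have [a aE] := closed_field_root (c^-1 / \det B) Nd0.
have a0 : a != 0.
  apply: contraTneq (mulf_neq0 (invr_neq0 c0) (invr_neq0 detB0)) => a0.
  by rewrite -aE a0 expr0n addn_eq0 (gtn_eqF d0) andbF eqxx.
have BAu : B *m map_mx sigma A \in unitmx by rewrite unitmx_mul Bu.
have aBAu : a *: (B *m map_mx sigma A) \in unitmx.
  by rewrite unitmxZ // unitfE.
exists (a *: (B *m map_mx sigma A)) => // i m.
rewrite orbit_coef_gal (orbit_coefE i m (homog_tuple_gal sigma fh) sAu).
rewrite (orbit_coefE i m fh aBAu).
rewrite (conj_endo_scalemx i fh a0 BAu) -(conj_endoM f i sAu Bu).
have -> : conj_endo (map_mx sigma A) (conj_endo B f) i =
    c *: conj_endo (map_mx sigma A) (gal_act sigma f) i.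
  rewrite -conj_endo_scalef /conj_endo; apply: eq_bigr => j _.
  by rewrite -fc.
rewrite !scalerA; congr (_ *: _)@__.
rewrite detZ det_mulmx exprS.
have -> : a ^+ d = a ^+ (N + d) / a ^+ N by rewrite addnC exprD mulfK ?expf_neq0.
rewrite aE; field.
by rewrite a0 c0 detB0 expf_neq0.
Qed.

End Orbit.

(** * A field of definition of bounded degree *)

Lemma number_or_local_field (F : fieldType) (K : pred F) :
  is_number_field K \/ is_completion_of_number_field K -> char0 F /\ is_subfield K.
Proof.
case=> [[? ? _] //|[R [v [K0 [subK [[charF _ _] _]]]]]]; by split.
Qed.

Theorem theorem1 (N d : nat) (hN : (1 <= N)%N) (hd : (2 <= d)%N) :
  exists C : nat,
    forall (Kbar : closedFieldType) (K : pred Kbar),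
      (is_number_field K \/ is_completion_of_number_field K) ->
      algebraic_over K ->
      forall f : poly_tuple Kbar N,
        is_endo d f ->
        moduli_in K f ->
        exists L : pred Kbar,
          [/\ is_subfield L, (forall x, x \in K -> x \in L),
              field_of_definition L f & degree_le K L C].
Proof.
pose J : finType := ('I_N.+1 * 'X_{1..N.+1 < d.+1})%type.
(* This bound is fixed before the field and [f] are introduced, so the constant depends on [N] and
   [d] alone. *)
pose e := \max_(q : J) \max_(p : J) msize (orbit_poly_int q.1 p.1 p.2 q.2).
exists ((relation_bound (N.+1 * N.+1) e.+1).-1 ^ #|J|)%N => F K KP algK f [fh _] fK.
have [charF subK] := number_or_local_field KP.
(* The nonvanishing of [g] singles out the invertible matrices. *)
pose g : {mpoly F[N.+1 * N.+1]} := \det (generic_mx N.+1 F).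
have gE x : g.@[x] = \det (vec_to_mx x).
  rewrite -det_map_mx; congr (\det _); apply/matrixP => i j.
  by rewrite !mxE /= mevalXU.
have unitE x : (g.@[x] != 0) = (vec_to_mx x \in unitmx) by rewrite gE unitmxE unitfE.
have g0 : g != 0.
  have [x x1] := vec_to_mx_surj (1%:M : 'M[F]_N.+1).
  have := unitE x; rewrite x1 unitmx1; apply: contraTneq => ->.
  by rewrite meval0 eqxx.
have ye (q : J) : (msize (orbit_poly f q) <= e.+2)%N.
  apply: (leq_trans (mmeasure_sum _ _ _ _)); apply/bigmax_leqP => p _.
  apply: (leq_trans (msizeZ_le _ _)); apply: (leq_trans (msize_map_mpoly _ _)).
  apply: (@leq_trans e); last by rewrite ltnW.
  by apply: (leq_trans _ (leq_bigmax q)); apply: (leq_bigmax p).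
have stable (sigma : {rmorphism F -> F}) x : in_Gal K sigma -> g.@[x] != 0 ->
    exists2 x' : 'I_(N.+1 * N.+1) -> F, g.@[x'] != 0 &
      forall q : J, sigma (orbit_poly f q).@[x] = (orbit_poly f q).@[x'].
  rewrite unitE => sG Au.
  have [B Bu sB] := orbit_stable (ltnW hd) fh fK sG Au.
  have [x' x'B] := vec_to_mx_surj B.
  by exists x'; [rewrite unitE x'B | move=> q; rewrite !orbit_polyE x'B sB].
have [x [L [gx [subL KL yL dL]]]] := bounded_degree_point charF subK algK ye g0 stable.
exists L; split=> //; rewrite unitE in gx; exists (vec_to_mx x) => //.
exists (fun i => \det (vec_to_mx x) *: conj_endo (vec_to_mx x) f i).
  by exists (\det (vec_to_mx x)) => //; rewrite -gE unitE.
(* Coefficients up to degree [d] are coordinates of the chosen point and lie in [L]; those of higher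
   degree vanish. *)
move=> i m; have [ltmd|ledm] := ltnP (mdeg m) d.+1.
  by have := yL (i, BMultinom ltmd); rewrite orbit_polyE /= orbit_coefE.
rewrite mcoeffZ (_ : _@_m = 0) ?mulr0; first exact: subfield0.
apply/eqP; rewrite mcoeff_eq0; apply: msize_mdeg_ge.
exact: leq_trans (msize_conj_endo _ _ fh) ledm.
Qed.
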